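(* Let $G\ge 1$ and $L,K\ge 0$ be integers, put $r=L+2K$, let $T$ be a set of time indices, and let $\varepsilon_\rho\in(0,1)$. For each $t\in T$ and $g\in\{1,\dots,G\}$ let $a_{t,g,\ell}\in\mathbb{R}$ ($1\le\ell\le L$) and $\rho_{t,g,k},\theta_{t,g,k}\in\mathbb{R}$ ($1\le k\le K$) be given, and define the token-conditioned local denominator $$Q_{t,g}(z^{-1})=\prod_{\ell=1}^{L}\left(1-a_{t,g,\ell}z^{-1}\right)\prod_{k=1}^{K}\left(1-2\rho_{t,g,k}\cos(\theta_{t,g,k})z^{-1}+\rho_{t,g,k}^{2}z^{-2}\right).$$ Assume that for all $t,g,\ell,k$ we have $|a_{t,g,\ell}|\le 1-\varepsilon_\rho$, $0<\rho_{t,g,k}\le 1-\varepsilon_\rho$, and $\theta_{t,g,k}\in[0,\pi]$. Then for every $t\in T$ and every $g$, the frozen local denominator $Q_{t,g}$ has all its poles strictly inside the unit disk $\{z\in\mathbb{C}:|z|<1\}$. Hence each $Q_{t,g}$ is Schur stable.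
   Context: ''Frozen'' means that $t$ is fixed, so that for each fixed pair $(t,g)$, $Q_{t,g}(z^{-1})$ is regarded as an ordinary polynomial of degree at most $r=L+2K$ in $z^{-1}$ with constant coefficients and constant term $1$. The poles of $Q_{t,g}$ are the complex roots, in the variable $z$, of the monic degree-$r$ polynomial $z^{r}Q_{t,g}(z^{-1})$. The denominator $Q_{t,g}$ is called Schur stable if all these poles lie in the open unit disk $\{z\in\mathbb{C}:|z|<1\}$. Empty products are equal to $1$. *)

(* Defs.v *)
From mathcomp Require Import all_boot all_order all_algebra.
From mathcomp Require Import complex.
From mathcomp Require Import reals trigo.

Set Implicit Arguments.
Unset Strict Implicit.
Unset Printing Implicit Defensive.

Import Order.TTheory GRing.Theory Num.Theory.
Local Open Scope ring_scope.
Local Open Scope complex_scope.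

(* A polynomial in z^-1 is a {poly R} whose indeterminate 'X stands for z^-1.
   Indices 1 <= l <= L and 1 <= k <= K are shifted to 'I_L and 'I_K. *)
Definition denominator (R : realType) (L K : nat)
    (a : 'I_L -> R) (rho theta : 'I_K -> R) : {poly R} :=
  (\prod_(l < L) (1 - a l *: 'X)) *
  (\prod_(k < K) (1 - (2 * rho k * cos (theta k)) *: 'X
                    + (rho k ^+ 2) *: 'X^2)).

(* z^r Q(z^-1) as a polynomial in z, for Q of degree at most r in z^-1: the
   coefficient of z^i is that of z^-(r - i) in Q (see horner_reciprocal).  The
   exponent r is a parameter, not the degree of Q: when the latter is smaller
   (some a l = 0), 0 is a root. *)
Definition reciprocal (F : nzRingType) (r : nat) (Q : {poly F}) : {poly F} :=
  \poly_(i < r.+1) Q`_(r - i).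

Definition pole (R : realType) (r : nat) (Q : {poly R}) (z : R[i]) : bool :=
  root (map_poly (real_complex R) (reciprocal r Q)) z.

(* In R[i] the norm is R[i]-valued with null imaginary part, so `|z| < 1
   compares moduli as real numbers. *)
Definition schur_stable (R : realType) (r : nat) (Q : {poly R}) : Prop :=
  forall z : R[i], pole r Q z -> `|z| < 1.

Lemma horner_reciprocal (F : fieldType) (r : nat) (Q : {poly F}) (z : F) :
  (size Q <= r.+1)%N -> z != 0 ->
  (reciprocal r Q).[z] = z ^+ r * Q.[z^-1].
Proof.
move=> sQ z0; rewrite horner_poly (horner_coef_wide _ sQ) mulr_sumr.
rewrite (reindex_inj rev_ord_inj) /=; apply: eq_bigr => i _.
have ir : (i <= r)%N by rewrite -ltnS ltn_ord.
by rewrite subSS subKn // mulrCA exprVn -exprB // unitfE.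
Qed.

Lemma monic_reciprocal (F : nzRingType) (r : nat) (Q : {poly F}) :
  Q`_0 = 1 -> reciprocal r Q \is monic /\ size (reciprocal r Q) = r.+1.
Proof.
move=> Q0; have sz : size (reciprocal r Q) = r.+1.
  by rewrite size_poly_eq // subnn Q0 oner_neq0.
by split=> //; rewrite monicE lead_coefE sz coef_poly leqnn subnn Q0.
Qed.

Lemma denominator_coef0 (R : realType) (L K : nat)
    (a : 'I_L -> R) (rho theta : 'I_K -> R) :
  (denominator a rho theta)`_0 = 1.
Proof.
rewrite -horner_coef0 hornerM !horner_prod !big1 ?mulr1 // => i _.
  by rewrite !hornerE /= ?expr0n /= ?mulr0 ?subr0 ?addr0.
by rewrite !hornerE /= ?mulr0 ?subr0.
Qed.

Lemma size_denominator (R : realType) (L K : nat)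
    (a : 'I_L -> R) (rho theta : 'I_K -> R) :
  (size (denominator a rho theta) <= (L + 2 * K).+1)%N.
Proof.
have size_prod_bound (n d : nat) (f : 'I_n -> {poly R}) :
    (forall i, (size (f i) <= d.+1)%N) -> (size (\prod_i f i)%R <= (d * n).+1)%N.
  elim: n f => [|n IH] f sf; first by rewrite big_ord0 size_poly1.
  rewrite big_ord_recr /=; apply: leq_trans (size_polyMleq _ _) _.
  have := leq_add (IH _ (fun i => sf (widen_ord (leqnSn n) i))) (sf ord_max).
  by rewrite addSn addnS mulnS [(d + _)%N]addnC; case: (_ + _)%N.
have size_scaleX (c : R) n : (size (c *: 'X^n : {poly R})%R <= n.+1)%N.
  by rewrite (leq_trans (size_scale_leq _ _)) // size_polyXn.
have sL (i : 'I_L) : (size (1 - a i *: 'X)%R <= 2)%N.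
  rewrite (leq_trans (size_polyD _ _)) // geq_max size_poly1 size_polyN.
  exact: (size_scaleX _ 1%N).
have sK (i : 'I_K) : (size (1 - (2 * rho i * cos (theta i)) *: 'X
    + (rho i ^+ 2) *: 'X^2)%R <= 3)%N.
  rewrite (leq_trans (size_polyD _ _)) // geq_max size_scaleX andbT.
  rewrite (leq_trans (size_polyD _ _)) // geq_max size_poly1 size_polyN.
  exact: leq_trans (size_scaleX _ 1%N) _.
rewrite (leq_trans (size_polyMleq _ _)) //.
have := leq_add (size_prod_bound _ 1%N _ sL) (size_prod_bound _ 2%N _ sK).
by rewrite mul1n addSn addnS; case: (_ + _)%N.
Qed.

(* Main.v *)
(* At a pole z <> 0, w = 1/z is a root of Q, hence of one of its factors.  A
   linear factor gives z = a; a quadratic factor gives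
   (z - rho e^(i theta)) (z - rho e^(-i theta)) = 0, so |z| = rho. *)
Require Import Defs.
From mathcomp Require Import all_boot all_order all_algebra.
From mathcomp Require Import complex.
From mathcomp Require Import reals trigo.
From mathcomp Require Import ring lra.

Set Implicit Arguments.
Unset Strict Implicit.
Unset Printing Implicit Defensive.

Import Order.TTheory GRing.Theory Num.Theory.
Local Open Scope ring_scope.
Local Open Scope complex_scope.

Lemma map_reciprocal (F E : nzRingType) (f : {rmorphism F -> E}) (r : nat)
    (Q : {poly F}) :
  map_poly f (reciprocal r Q) = reciprocal r (map_poly f Q).
Proof.
apply/polyP => i; rewrite coef_map coef_poly [RHS]coef_poly coef_map.
by case: ifP; rewrite ?raddf0.
Qed.

(** The reciprocal at [z] equals [z ^+ r] times the value of [Q] at [z^-1], and the power of [z]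
    cannot vanish. *)
Lemma pole_inverse_root (R : realType) (r : nat) (Q : {poly R}) (z : R[i]) :
  (size Q <= r.+1)%N -> z != 0 -> pole r Q z ->
  root (map_poly (real_complex R) Q) z^-1.
Proof.
move=> sQ z0; rewrite /pole map_reciprocal /root horner_reciprocal //.
  by rewrite mulf_eq0 expf_eq0 (negPf z0) andbF.
by rewrite size_map_poly.
Qed.

Lemma root_linear_factor (R : realType) (a : R) (w : R[i]) :
  root (map_poly (real_complex R) (1 - a *: 'X)) w -> w^-1 = a%:C.
Proof.
rewrite /root rmorphB rmorph1 /= map_polyZ map_polyX !hornerE subr_eq0.
move=> /eqP aw; have {}aw : a%:C * w = 1 by rewrite -aw.
(* The relation [a%:C * w = 1] itself excludes [w = 0]. It is also contradictory when [a = 0]: such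
   a factor is constant and has no root. *)
have w0 : w != 0.
  by apply/eqP => w0; move/eqP: aw; rewrite w0 mulr0 eq_sym oner_eq0.
by rewrite -[RHS](mulfK w0) aw mul1r.
Qed.

(** The Pythagorean identity reduces the modulus to the square root of [rho ^+ 2]; the sign of [rho]
    removes the absolute value. *)
Lemma normc_polar (R : realType) (rho theta : R) :
  0 <= rho ->
  `|(rho * cos theta) +i* (rho * sin theta)| = rho%:C :> R[i].
Proof.
move=> rho0; rewrite normc_def /= !exprMn -mulrDr cos2Dsin2 mulr1.
by rewrite sqrtr_sqr ger0_norm.
Qed.

Lemma root_quadratic_factor (R : realType) (rho theta : R) (w : R[i]) :
  0 <= rho -> w != 0 ->
  root (map_poly (real_complex R)
    (1 - (2 * rho * cos theta) *: 'X + (rho ^+ 2) *: 'X^2)) w ->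
  `|w^-1| = rho%:C.
Proof.
move=> rho0 w0.
rewrite /root rmorphD rmorphB rmorph1 /= !map_polyZ map_polyXn map_polyX.
rewrite !hornerE => /eqP rw.
have {}rw : 1 - (2 * rho * cos theta)%:C * w + (rho ^+ 2)%:C * w ^+ 2 = 0.
  by rewrite -[RHS]rw expr2 mulrA.
(* [p s] is rho e^(i s), so [p theta] and [p (- theta)] are conjugate. Their sum and product are the
   coefficients of the quadratic, as in Vieta's formulas. *)
pose p (s : R) : R[i] := (rho * cos s) +i* (rho * sin s).
have sum_p : p theta + p (- theta) = (2 * rho * cos theta)%:C.
  by rewrite /p cosN sinN; apply/eqP; rewrite eq_complex /=; apply/andP; split;
     apply/eqP; ring.
have prod_p : p theta * p (- theta) = (rho ^+ 2)%:C.
  rewrite /p cosN sinN; apply/eqP; rewrite eq_complex /=; apply/andP; split;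
    apply/eqP; last by ring.
  (* Writing 1 as cos^2 + sin^2 turns the real part into a polynomial identity. *)
  rewrite -[RHS]mulr1 -(cos2Dsin2 theta); ring.
have : (w^-1 - p theta) * (w^-1 - p (- theta)) = 0.
  (* Dividing the quadratic in [w] by [w ^+ 2] gives a monic quadratic in [w^-1], which splits. *)
  transitivity (w^-1 ^+ 2 * (1 - (p theta + p (- theta)) * w
                             + p theta * p (- theta) * w ^+ 2)).
    by field.
  by rewrite sum_p prod_p rw mulr0.
by move=> /eqP; rewrite mulf_eq0 !subr_eq0 => /orP[] /eqP ->;
  rewrite normc_polar.
Qed.

Theorem proposition2 (R : realType) (G L K : nat) (hG : (1 <= G)%N)
    (T : Type) (eps_rho : R) (heps : 0 < eps_rho < 1)
    (a : T -> 'I_G -> 'I_L -> R)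
    (rho theta : T -> 'I_G -> 'I_K -> R)
    (ha : forall t g l, `|a t g l| <= 1 - eps_rho)
    (hrho : forall t g k, 0 < rho t g k <= 1 - eps_rho)
    (htheta : forall t g k, 0 <= theta t g k <= pi) :
  let r := (L + 2 * K)%N in
  let Q := fun t g => denominator (a t g) (rho t g) (theta t g) in
  (forall t g (z : R[i]), pole r (Q t g) z -> `|z| < 1) /\
  (forall t g, schur_stable r (Q t g)).
Proof.
move=> r Q.
have stable t g (z : R[i]) : pole r (Q t g) z -> `|z| < 1.
  (* The origin has no inverse, so it is handled apart; it is a pole when some [a t g l] is 0. *)
  have [-> _|z0] := eqVneq z 0; first by rewrite normr0.
  move=> /(pole_inverse_root (size_denominator _ _ _) z0).
  rewrite /Q /denominator rmorphM /= rootM => /orP[].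
    rewrite rmorph_prod /root horner_prod => /prodf_eq0[l _].
    move=> /root_linear_factor; rewrite invrK => ->.
    (* The pole is real, so its modulus is the absolute value of [a t g l]; the margin [eps_rho > 0]
       makes the bound strict. *)
    by rewrite normc_def /= expr0n addr0 sqrtr_sqr ltcR; have := ha t g l; lra.
  rewrite rmorph_prod /root horner_prod => /prodf_eq0[k _].
  have /andP[rho0 rho1] := hrho t g k.
  move=> /(root_quadratic_factor (ltW rho0)); rewrite invr_eq0 invrK => -> //.
  by rewrite ltcR; lra.
by split.
Qed.
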